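(* Let $M$ be a monoid. Let $\Phi_M:\mathsf{NorSub}(M)\to\mathsf{Cong}(M)$ be the map sending each normal submonoid $S$ of $M$ to the congruence $R_S$ induced by $S$, and let $\Psi_M:\mathsf{Cong}(M)\to\mathsf{NorSub}(M)$ be the map $R\mapsto[1]_R$. Then: (a) $\Phi_M$ is a join-homomorphism, and $\Psi_M$ is a meet-homomorphism; (b) $\Phi_M$ is a (set-theoretic) section of $\Psi_M$, i.e. $\Psi_M\circ\Phi_M=\mathrm{id}$. In particular, $\Phi_M$ is one-to-one.
   Context: For a monoid $M$ with identity $1$, $U(M)$ denotes its group of units (elements with a two-sided inverse). A groupal submonoid of $M$ is a submonoid $S\subseteq M$ such that $x^{-1}\in S$ for every $x\in S\cap U(M)$. For $A\subseteq M$ and $x,y\in M$, $xAy=\{xay : a\in A\}$. A subset $A\subseteq M$ is invariant if for each $x,y\in M$ the following three conditions are equivalent: (i) $xAy\subseteq A$; (ii) $xy\in A$; (iii) $(xAy)\cap A\neq\emptyset$. A normal submonoid of $M$ is a submonoid which is both groupal and invariant. $\mathsf{NorSub}(M)$, the set of normal submonoids of $M$ ordered by inclusion, is a complete lattice, with meets given by intersection and the join of a family given by the smallest normal submonoid containing its union. $\mathsf{Cong}(M)$, the set of congruences on $M$ (equivalence relations compatible with the product) ordered by inclusion, is a complete lattice, with meets given by intersection and the join of a family given by the smallest congruence containing its union. For a congruence $R$, $[1]_R$ is the equivalence class of $1$; it is always a normal submonoid of $M$. For a subset $A\subseteq M$, the congruence $R_A$ induced by $A$ is the smallest congruence on $M$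 containing $\{1\}\times A$. *)

(* Defs.v *)
From HB Require Import structures.
From mathcomp Require Import all_boot all_order.
From mathcomp Require Import boolp classical_sets.

Set Implicit Arguments.
Unset Strict Implicit.
Unset Printing Implicit Defensive.

Local Open Scope classical_set_scope.
Local Open Scope group_scope.

Section MonoidSubsets.
Variable M : monoidType.
Implicit Types (A : set M) (R : set (M * M)) (x y : M).

Definition is_submonoid A : Prop :=
  A 1 /\ forall x y, A x -> A y -> A (x * y).

Definition is_inverse x y : Prop := x * y = 1 /\ y * x = 1.

Definition is_groupal A : Prop :=
  is_submonoid A /\ forall x y, is_inverse x y -> A x -> A y.

Definition sandwich x A y : set M := [set x * a * y | a in A].

Definition is_invariant A : Prop :=
  forall x y, (sandwich x A y `<=` A <-> A (x * y)) /\
              (A (x * y) <-> sandwich x A y `&` A !=set0).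

Definition is_normal A : Prop := is_groupal A /\ is_invariant A.

(* Binary relations on M are subsets of M * M. *)
Definition is_congruence R : Prop :=
  [/\ forall x, R (x, x),
      forall x y, R (x, y) -> R (y, x),
      forall x y z, R (x, y) -> R (y, z) -> R (x, z)
    & forall x x' y y', R (x, x') -> R (y, y') -> R (x * y, x' * y')].

Definition class_one R : set M := [set x | R (1, x)].

End MonoidSubsets.

Record NorSub (M : monoidType) := MkNorSub {
  norsub_set :> set M;
  norsubP : is_normal norsub_set }.

Record Cong (M : monoidType) := MkCong {
  cong_set :> set (M * M);
  congP : is_congruence cong_set }.

Section Closure.
Variable M : monoidType.

Lemma bigcap_normal (I : Type) (D : set I) (F : I -> set M) :
  (forall i, D i -> is_normal (F i)) -> is_normal (\bigcap_(i in D) F i).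
Proof.
move=> nF.
have cap1 : (\bigcap_(i in D) F i) 1 by move=> i /nF[[[]]].
split; first split; first split => //.
- by move=> x y Ax Ay i Di; have [[[_ mF] _] _] := nF i Di; exact: mF (Ax i Di) (Ay i Di).
- move=> x y xy Ax i Di; have [[_ gF] _] := nF i Di; exact: gF xy (Ax i Di).
move=> x y; split; split.
- by move=> sub; have := sub (x * 1 * y); rewrite mulg1; apply; exists 1 => //; rewrite mulg1.
- move=> Axy _ [a Aa <-] i Di; have [_ iF] := nF i Di.
  by apply: (iF x y).1.2 (Axy i Di) _ _; exists a => //; exact: Aa.
- by move=> Axy; exists (x * y); split => //; exists 1 => //; rewrite mulg1.
- move=> [_ [[a Aa <-] Axay]] i Di; have [_ iF] := nF i Di.
  by apply: (iF x y).2.2; exists (x * a * y); split; [exists a => //; exact: Aa|exact: Axay].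
Qed.

Lemma bigcap_congruence (I : Type) (D : set I) (F : I -> set (M * M)) :
  (forall i, D i -> is_congruence (F i)) ->
  is_congruence (\bigcap_(i in D) F i).
Proof.
move=> cF; split.
- by move=> x i /cF[].
- by move=> x y Rxy i Di; have [_ sF _ _] := cF i Di; exact: sF (Rxy i Di).
- by move=> x y z Rxy Ryz i Di; have [_ _ tF _] := cF i Di;
    exact: tF (Rxy i Di) (Ryz i Di).
- by move=> x x' y y' Rx Ry i Di; have [_ _ _ mF] := cF i Di;
    exact: mF (Rx i Di) (Ry i Di).
Qed.

Lemma smallest_normal (A : set M) : is_normal (smallest (@is_normal M) A).
Proof. by apply: bigcap_normal => B []. Qed.

Lemma smallest_congruence (X : set (M * M)) :
  is_congruence (smallest (@is_congruence M) X).
Proof. by apply: bigcap_congruence => B []. Qed.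

Lemma class_one_normal (R : set (M * M)) :
  is_congruence R -> is_normal (class_one R).
Proof.
move=> [rR sR tR mR].
have mid x y a : class_one R a -> R (x * y, x * a * y).
  by move=> Ra; rewrite -{1}(mulg1 x); apply: (mR) => //; exact: mR.
split; first split; first split; rewrite /class_one /=.
- exact: rR.
- by move=> x y Rx Ry; rewrite -(mulg1 1); exact: mR.
- by move=> x y [xy yx] Rx; apply: sR; rewrite -xy -{1}(mul1g y); exact: mR.
move=> x y; split; split.
- by move=> sub; have := sub (x * 1 * y); rewrite mulg1; apply; exists 1;
    [exact: rR|rewrite mulg1].
- by move=> Rxy _ [a Ra <-]; exact: tR Rxy (mid _ _ _ Ra).
- move=> Rxy; exists (x * y); split => //; exists 1; [exact: rR|by rewrite mulg1].
- by move=> [_ [[a Ra <-] Rxay]]; apply: tR Rxay _; exact/sR/mid.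
Qed.

Lemma norsub_eq (S T : NorSub M) : norsub_set S = norsub_set T -> S = T.
Proof.
case: S T => [A nA] [B nB] /= AB; case: B / AB nB => nB.
by rewrite (Prop_irrelevance nA nB).
Qed.

Lemma cong_eq (R T : Cong M) : cong_set R = cong_set T -> R = T.
Proof.
case: R T => [A nA] [B nB] /= AB; case: B / AB nB => nB.
by rewrite (Prop_irrelevance nA nB).
Qed.

End Closure.

HB.instance Definition _ (M : monoidType) := gen_eqMixin (NorSub M).
HB.instance Definition _ (M : monoidType) := gen_choiceMixin (NorSub M).
HB.instance Definition _ (M : monoidType) := gen_eqMixin (Cong M).
HB.instance Definition _ (M : monoidType) := gen_choiceMixin (Cong M).

Section InclusionOrder.
Variable M : monoidType.

Definition norsub_le (S T : NorSub M) : bool := `[< S `<=` T >].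
Definition cong_le (R T : Cong M) : bool := `[< R `<=` T >].

Fact norsub_le_refl : reflexive norsub_le.
Proof. by move=> S; apply/asboolP. Qed.
Fact norsub_le_anti : antisymmetric norsub_le.
Proof.
by move=> S T /andP[/asboolP ST /asboolP TS]; apply: norsub_eq; apply/seteqP.
Qed.
Fact norsub_le_trans : transitive norsub_le.
Proof.
by move=> T S U /asboolP ST /asboolP TU; apply/asboolP; exact: subset_trans TU.
Qed.
Fact cong_le_refl : reflexive cong_le.
Proof. by move=> S; apply/asboolP. Qed.
Fact cong_le_anti : antisymmetric cong_le.
Proof.
by move=> S T /andP[/asboolP ST /asboolP TS]; apply: cong_eq; apply/seteqP.
Qed.
Fact cong_le_trans : transitive cong_le.
Proof.
by move=> T S U /asboolP ST /asboolP TU; apply/asboolP; exact: subset_trans TU.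
Qed.

Fact inclusion_display : Order.disp_t. Proof. exact: Order.Disp tt tt. Qed.

HB.instance Definition _ := Order.Le_isPOrder.Build inclusion_display
  (NorSub M) norsub_le_refl norsub_le_anti norsub_le_trans.
HB.instance Definition _ := Order.Le_isPOrder.Build inclusion_display
  (Cong M) cong_le_refl cong_le_anti cong_le_trans.

End InclusionOrder.

Section CompleteLattices.
Variable M : monoidType.

Definition norsub_meet (F : set (NorSub M)) : NorSub M :=
  MkNorSub (@bigcap_normal M _ F (@norsub_set M) (fun S _ => norsubP S)).

Definition norsub_join (F : set (NorSub M)) : NorSub M :=
  MkNorSub (smallest_normal (\bigcup_(S in F) S)).

Definition cong_meet (F : set (Cong M)) : Cong M :=
  MkCong (@bigcap_congruence M _ F (@cong_set M) (fun R _ => congP R)).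

Definition cong_join (F : set (Cong M)) : Cong M :=
  MkCong (smallest_congruence (\bigcup_(R in F) R)).

Lemma norsub_meetP F : infimums F (norsub_meet F).
Proof.
split=> [S FS | T lbT]; apply/asboolP => x; first exact.
by move=> Tx S FS; have /asboolP := lbT S FS; exact.
Qed.

Lemma norsub_joinP F : supremums F (norsub_join F).
Proof.
split=> [S FS | T ubT]; apply/asboolP.
  apply: subset_trans (@sub_gen_smallest _ _ _); exact: bigcup_sup.
apply: smallest_sub; first exact: norsubP.
by apply: bigcup_sub => S FS; have /asboolP := ubT S FS.
Qed.

Lemma cong_meetP F : infimums F (cong_meet F).
Proof.
split=> [S FS | T lbT]; apply/asboolP => x; first exact.
by move=> Tx S FS; have /asboolP := lbT S FS; exact.
Qed.

Lemma cong_joinP F : supremums F (cong_join F).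
Proof.
split=> [S FS | T ubT]; apply/asboolP.
  apply: subset_trans (@sub_gen_smallest _ _ _); exact: bigcup_sup.
apply: smallest_sub; first exact: congP.
by apply: bigcup_sub => S FS; have /asboolP := ubT S FS.
Qed.

End CompleteLattices.

Definition induced_congruence (M : monoidType) (A : set M) : Cong M :=
  MkCong (smallest_congruence ([set 1] `*` A)).

Definition Phi (M : monoidType) (S : NorSub M) : Cong M :=
  induced_congruence S.

Definition Psi (M : monoidType) (R : Cong M) : NorSub M :=
  MkNorSub (class_one_normal (congP R)).

(* Main.v *)
(** [Phi] is left adjoint to [Psi], whence the preservation of joins and meets.
    For [Psi (Phi S) = S], the syntactic congruence of [S], relating [x] and [y]
    when [u x v] and [u y v] belong to [S] for the same pairs [(u, v)], identifies
    [1] with every element of [S] by invariance, so it contains [Phi S]; taking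
    [u = v = 1], its class of [1] lies in [S]. *)
Require Import Defs.
From mathcomp Require Import all_boot all_order.
From mathcomp Require Import boolp classical_sets.

Local Open Scope classical_set_scope.

Section PhiPsi.
Variable M : monoidType.
Implicit Types (A : set M) (S T : NorSub M) (R : Cong M).

(** By minimality of [Phi S], only the pairs [(1, x)] with [x] in [S] need testing. *)
Lemma Phi_sub_iff S R : (Phi S `<=` R) <-> (S `<=` Psi R).
Proof.
split=> [sub x Sx | sub].
  by apply: sub; apply: sub_gen_smallest; split.
apply: smallest_sub; first exact: congP.
by move=> [a x] /= [-> Sx]; exact: sub.
Qed.

Lemma Phi_mono S T : S `<=` T -> Phi S `<=` Phi T.
Proof. by move=> ST; apply/Phi_sub_iff; apply: (subset_trans ST); apply/Phi_sub_iff. Qed.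

Lemma Phi_join (F : set (NorSub M)) :
  Phi (norsub_join F) = cong_join [set Phi S | S in F].
Proof.
apply: cong_eq; apply/seteqP; split.
  (* Adjunction moves the goal into a normal submonoid, where each [S] can be tested separately. *)
  apply/Phi_sub_iff; apply: smallest_sub; first exact: norsubP.
  apply: bigcup_sub => S FS; apply/Phi_sub_iff.
  apply: subset_trans (@sub_gen_smallest _ _ _).
  by apply: (bigcup_sup (i := Phi S)); exists S.
apply: smallest_sub; first exact: congP.
apply: bigcup_sub => _ [S FS <-]; apply: Phi_mono.
by apply: subset_trans (@sub_gen_smallest _ _ _); exact: bigcup_sup.
Qed.

Lemma Psi_meet (F : set (Cong M)) :
  Psi (cong_meet F) = norsub_meet [set Psi R | R in F].
Proof.
apply: norsub_eq; apply/seteqP; split=> x xF.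
  by move=> _ [R FR <-]; exact: xF.
by move=> R FR; apply: (xF (Psi R)); exists R.
Qed.

Definition syntactic A : set (M * M) :=
  [set p | forall u v : M, A (u * p.1 * v)%g <-> A (u * p.2 * v)%g].

Lemma syntactic_congruence A : is_congruence (syntactic A).
Proof.
split=> [x u v | x y xy u v | x y z xy yz u v | x x' y y' xx' yy' u v] //=.
- exact: iff_sym (xy u v).
- exact: iff_trans (xy u v) (yz u v).
(* One factor changes at a time; the other is absorbed into the context. *)
apply: (@iff_trans _ (A (u * (x' * y) * v)%g)).
  by have := xx' u (y * v)%g; rewrite /= !mulgA.
by have := yy' (u * x')%g v; rewrite /= !mulgA.
Qed.

Lemma syntactic_invariant {A} {a : M} :
  is_invariant A -> A a -> syntactic A (1%g, a).
Proof.
move=> iA Aa u v; rewrite /= mulg1; split=> [Auv | Auav].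
  (* Invariance gives (ii) => (i) here and (iii) => (ii) for the converse. *)
  by apply: (iA u v).1.2 Auv _ _; exists a.
by apply: (iA u v).2.2; exists (u * a * v)%g; split=> //; exists a.
Qed.

Lemma PhiK : cancel (@Phi M) (@Psi M).
Proof.
(* The inclusion of [S] in [Psi (Phi S)] is the unit of the adjunction. *)
move=> S; apply: norsub_eq; apply/seteqP; split; last exact/Phi_sub_iff.
have [[[S1 _] _] iS] := norsubP S.
have Phi_syn : Phi S `<=` MkCong (syntactic_congruence S).
  by apply/Phi_sub_iff => a; exact: syntactic_invariant.
move=> x /Phi_syn /(_ 1%g 1%g); rewrite /= !mulg1 mul1g.
by move=> [/(_ S1)].
Qed.

End PhiPsi.

Theorem theorem3p6 (M : monoidType) :
  ((forall F : set (NorSub M),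
      Phi (norsub_join F) = cong_join [set Phi S | S in F]) /\
   (forall F : set (Cong M),
      Psi (cong_meet F) = norsub_meet [set Psi R | R in F])) /\
  (@Psi M \o @Phi M = id /\ injective (@Phi M)).
Proof.
split; first by split; [exact: Phi_join | exact: Psi_meet].
split; last exact: can_inj (@PhiK M).
by apply/funext => S; exact: PhiK.
Qed.
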